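(* The spectrum function $\Sigma^{\mathbb{I}}:(\mathcal{LP}(\mathbb{I},\mathbb{R}^n),d_{\mathbb{I}})\to(\mathcal{K}(\mathbb{R}),d_{\mathrm H})$ is Lipschitz continuous with Lipschitz constant $1$.
   Context: Let $n\ge 1$, let $|\cdot|$ be an arbitrary fixed norm on $\mathbb{R}^n$ with unit sphere $\mathcal{S}$ and induced operator norm $\|\cdot\|$. Let $\mathbb{I}\subset\mathbb{R}$ be compact (not necessarily an interval), $t_-=\min\mathbb{I}$, $t_+=\max\mathbb{I}$, $t_-<t_+$. Put $\mathbb{I}^2_{\neq}=\{(t,s)\in\mathbb{I}\times\mathbb{I}: t\neq s\}$ and let $\overline{\mathbb{I}^2_{\neq}}$ be its closure in $\mathbb{R}^2$. A linear process on $\mathbb{I}$ is a family $\Phi(t,s)\in GL(n,\mathbb{R})$, $t,s\in\mathbb{I}$, such that $(t,s,x)\mapsto\Phi(t,s)x$ is continuous, $\Phi(t,t)=\mathrm{id}$, $\Phi(t,s)\Phi(s,r)=\Phi(t,r)$ for all $t,s,r\in\mathbb{I}$, and $t\mapsto\Phi(t,s)$ is Lipschitz continuous in operator norm for every $s\in\mathbb{I}$. For continuous $f:\mathbb{I}\to(0,\infty)$ let $\Delta(f)(t,s)=\frac{\ln f(t)-\ln f(s)}{t-s}$, $(t,s)\in\mathbb{I}^2_{\neq}$. Standing assumption: $\mathcal{LP}(\mathbb{I},\mathbb{R}^n)$ denotes the set of linear processes $\Phi$ on $\mathbb{I}$ for which $(x,t,s)\mapsto\Delta(|\Phi(\cdot,t_-)x|)(t,s)$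 extends continuously from $\mathcal{S}\times\mathbb{I}^2_{\neq}$ to $\mathcal{S}\times\overline{\mathbb{I}^2_{\neq}}$; the extension is denoted by the same symbol. $\mathrm{Gr}(k,\mathbb{R}^n)$ is the set of $k$-dimensional subspaces of $\mathbb{R}^n$. For a subspace $X\neq\{0\}$, $\underline{\lambda}(X,\Phi)$ and $\overline{\lambda}(X,\Phi)$ are the minimum and the maximum, respectively, of $\Delta(|\Phi(\cdot,t_-)x|)(t,s)$ over $x\in X\cap\mathcal{S}$, $(t,s)\in\overline{\mathbb{I}^2_{\neq}}$. Extremal growth rates: for $k\in\{1,\ldots,n\}$, $\underline{\lambda}_k(\Phi)=\max_{X\in\mathrm{Gr}(k,\mathbb{R}^n)}\underline{\lambda}(X,\Phi)$ and $\overline{\lambda}_k(\Phi)=\min_{X\in\mathrm{Gr}(k,\mathbb{R}^n)}\overline{\lambda}(X,\Phi)$; moreover $\underline{\lambda}_0(\Phi)=\infty$, $\overline{\lambda}_0(\Phi)=-\infty$. $\Phi$ admits an exponential monotonicity dichotomy (EMD) on $\mathbb{I}$ if there is $k\in\{0,\ldots,n\}$ with $\overline{\lambda}_k(\Phi)<0<\underline{\lambda}_{n-k}(\Phi)$. For $\gamma\in\mathbb{R}$ put $\Phi_\gamma(t,s)=e^{-\gamma(t-s)}\Phi(t,s)$. The (finite-time dichotomy) spectrum is $\Sigma^{\mathbb{I}}(\Phi)=\{\gamma\in\mathbb{R}:\Phi_\gamma\text{ does not admit an EMD on }\mathbb{I}\}$; it is a nonempty compact subset of $\mathbb{R}$.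 $\mathcal{K}(\mathbb{R})$ is the set of (nonempty) compact subsets of $\mathbb{R}$ and $d_{\mathrm H}$ the Hausdorff metric on it. Metric on $\mathcal{LP}(\mathbb{I},\mathbb{R}^n)$: $$\tilde d_{\mathbb{I}}(\Phi,\Psi)=\sup_{X\in\mathrm{Gr}(1,\mathbb{R}^n)}\max\{|\underline{\lambda}(X,\Phi)-\underline{\lambda}(X,\Psi)|,|\overline{\lambda}(X,\Phi)-\overline{\lambda}(X,\Psi)|\},$$ $$d_{\mathbb{I}}(\Phi,\Psi)=\max\Big\{\sup_{x\in\mathcal{S}}\sup_{t\in\mathbb{I}}|(\Phi(t,t_-)-\Psi(t,t_-))x|,\ \tilde d_{\mathbb{I}}(\Phi,\Psi)\Big\}.$$ *)

(* Defs.v *)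
From mathcomp Require Import all_boot all_order all_algebra.
From mathcomp Require Import all_classical all_reals all_analysis.
Import Order.TTheory GRing.Theory Num.Theory.
Import numFieldNormedType.Exports.
Set Implicit Arguments.
Unset Strict Implicit.
Unset Printing Implicit Defensive.
Local Open Scope classical_set_scope.
Local Open Scope ring_scope.

Section Norms.
Context {R : realType} {n : nat}.
Implicit Types (N : 'cV[R]_n -> R) (A : 'M[R]_n).

Definition is_norm N : Prop :=
  [/\ forall x y, N (x + y) <= N x + N y,
      forall (a : R) x, N (a *: x) = `|a| * N x &
      forall x, N x = 0 -> x = 0].

Definition unit_sphere N : set 'cV[R]_n := [set x | N x = 1].

Definition operator_norm N A : R :=
  sup [set N (A *m x) | x in unit_sphere N].

End Norms.

(* Processes are total functions of time, but only their values on the compact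
   time set J are ever constrained or used. *)
Section LinearProcesses.
Context {R : realType} {n : nat}.
Variables (N : 'cV[R]_n -> R) (J : set R).
Implicit Types (Phi Psi : R -> R -> 'M[R]_n) (X : {vspace 'cV[R]_n}).

(* For compact J, [inf J] and [sup J] are min J and max J. *)
Definition offdiag : set (R * R) :=
  [set p | [/\ J p.1, J p.2 & p.1 != p.2]].

Definition linear_process Phi : Prop :=
  [/\ forall t s, J t -> J s -> Phi t s \in unitmx,
      {within (J `*` J) `*` [set: 'cV[R]_n],
        continuous (fun p => Phi p.1.1 p.1.2 *m p.2)},
      forall t, J t -> Phi t t = 1%:M,
      forall t s r, J t -> J s -> J r -> Phi t s *m Phi s r = Phi t r &
      forall s, J s -> exists L : R, forall t u, J t -> J u ->
        operator_norm N (Phi t s - Phi u s) <= L * `|t - u|].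

Definition log_diff_quot (f : R -> R) (p : R * R) : R :=
  (ln (f p.1) - ln (f p.2)) / (p.1 - p.2).

Definition growth_extension Phi (D : 'cV[R]_n * (R * R) -> R) : Prop :=
  {within unit_sphere N `*` closure offdiag, continuous D} /\
  forall x p, unit_sphere N x -> offdiag p ->
    D (x, p) = log_diff_quot (fun t => N (Phi t (inf J) *m x)) p.

Definition LP Phi : Prop :=
  linear_process Phi /\ exists D, growth_extension Phi D.

(* An extension is unique on [unit_sphere N `*` closure offdiag], the only
   place where [growth Phi] is evaluated below; the default value of [xget] is
   never taken for Phi in [LP]. *)
Definition growth Phi : 'cV[R]_n * (R * R) -> R :=
  xget (fun=> 0) [set D | growth_extension Phi D].

Definition growth_values X Phi : set R :=
  growth Phi @` ([set x | x \in X /\ unit_sphere N x] `*` closure offdiag).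

(* For Phi in [LP] and X nonzero, [growth_values X Phi] is nonempty and compact,
   so that these are a minimum and a maximum. *)
Definition lower_rate X Phi : R := inf (growth_values X Phi).
Definition upper_rate X Phi : R := sup (growth_values X Phi).

Definition Gr (k : nat) : set {vspace 'cV[R]_n} := [set X | \dim X = k].

Definition lower_ext_rate (k : nat) Phi : \bar R :=
  if k == 0%N then +oo%E else (sup [set lower_rate X Phi | X in Gr k])%:E.

Definition upper_ext_rate (k : nat) Phi : \bar R :=
  if k == 0%N then -oo%E else (inf [set upper_rate X Phi | X in Gr k])%:E.

Definition EMD Phi : Prop :=
  exists k : nat, [/\ (k <= n)%N,
    (upper_ext_rate k Phi < 0)%E & (0 < lower_ext_rate (n - k) Phi)%E].

Definition shift_process (gamma : R) Phi : R -> R -> 'M[R]_n :=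
  fun t s => expR (- gamma * (t - s)) *: Phi t s.

Definition spectrum Phi : set R :=
  [set gamma | ~ EMD (shift_process gamma Phi)].

Definition rate_dist Phi Psi : R :=
  sup [set Num.max `|lower_rate X Phi - lower_rate X Psi|
                   `|upper_rate X Phi - upper_rate X Psi| | X in Gr 1%N].

Definition process_dist Phi Psi : R :=
  Num.max
    (sup [set sup [set N ((Phi t (inf J) - Psi t (inf J)) *m x) | t in J]
         | x in unit_sphere N])
    (rate_dist Phi Psi).

End LinearProcesses.

Section Hausdorff.
Context {R : realType}.
Implicit Types A B : set R.

Definition nonempty_compact A : Prop := A !=set0 /\ compact A.

Definition dist_to_set (a : R) B : R := inf [set `|a - b| | b in B].

Definition hausdorff_dist A B : R :=
  Num.max (sup [set dist_to_set a B | a in A])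
          (sup [set dist_to_set b A | b in B]).

End Hausdorff.

(* Main.v *)
Require Import Defs.
From mathcomp Require Import all_boot all_order all_algebra.
From mathcomp Require Import all_classical all_reals all_analysis.
From mathcomp Require Import ring lra zify.
Import Order.TTheory GRing.Theory Num.Theory.
Import numFieldNormedType.Exports.
Set Implicit Arguments.
Unset Strict Implicit.
Unset Printing Implicit Defensive.
Local Open Scope classical_set_scope.
Local Open Scope ring_scope.

(** Write u_k and l_k for the extremal growth rates of a process.  Shifting a
    process by gamma subtracts gamma from its growth function, hence from all
    its rates ([ext_rates_shift]), so the spectrum is what remains of the real
    line after removal of the open gaps ]u_k, l_(n-k)[ for 0 <= k <= n
    ([spectrumE]).

    Two subspaces whose dimensions add up to more than n share a unit vector, and
    the growth of that vector lies above the lower rate of one and below the upper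
    rate of the other; therefore l_j <= u_k as soon as n < j + k
    ([lower_le_upper_cross], [rate_ladder_ext_rates]).  The rest is
    one-dimensional.  These inequalities make distinct gaps disjoint and put the
    right end l_(n-k) of every nonempty gap with k < n into the spectrum
    ([gap_endpoint]).  The gap with k = 0 is a nonempty half-line ending at l_n,
    so the spectrum is nonempty; it is closed, and it is contained in
    [l_n, u_n].

    For the Lipschitz estimate let d be the distance of the rates of Phi and Psi on
    lines.  The rates of a subspace X are the infimum and the supremum of the rates
    of the lines in X, so they also differ by at most d, and then so do the u_k
    and the l_k ([ext_rates_lipschitz]).  Let a be in the spectrum of Phi and
    suppose that [a - d, a + d] misses the spectrum of Psi.  The gap of Psi
    containing a - d must contain a + d too, since otherwise its right end would
    be a point of the spectrum in that interval.  A gap of Psi with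
    u_k < a - d and a + d < l_(n-k) becomes a gap of Phi around a, a
    contradiction ([outside_gaps_near]).

    Infima and suprema behave as expected because the growth function is bounded:
    it is continuous on the product of the unit sphere, compact by the equivalence
    of norms, and of the compact closure of the off-diagonal times. *)

(** * Norms on column vectors *)

Section ColumnNorms.
Context {R : realType} {n : nat}.

Lemma ler_norm_trmx (p q : nat) (x : 'M[R]_(p, q)) : `|x^T| <= `|x|.
Proof.
rewrite [leLHS]/Num.norm [leRHS]/Num.norm /= !mx_normrE.
apply: bigmax_le => [|[i j] _]; first exact: bigmax_ge_id.
by rewrite mxE; exact: (le_bigmax _ (fun ij => `|x ij.1 ij.2|) (j, i)).
Qed.

Lemma trmx_continuous (p q : nat) : continuous (@trmx R p q).
Proof.
move=> x; apply/(@cvgrPdist_lt _ _ _ (nbhs x) (nbhs_filter x)) => e e0.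
apply: filterS (nbhsx_ballx x e e0) => y; rewrite -ball_normE /ball_/= => xy.
by rewrite -linearB; apply: (le_lt_trans _ xy); exact: ler_norm_trmx.
Qed.

(** Transposition is an isometry of the sup norms, which transports the
    Heine-Borel property of row vectors to column vectors. *)
Lemma bounded_closed_compact_col (A : set 'cV[R]_n) :
  bounded_set A -> closed A -> compact A.
Proof.
move=> bA cA.
have -> : A = @trmx R 1 n @` ((@trmx R 1 n) @^-1` A).
  apply/seteqP; split => [x Ax|_ [x Ax <-]//].
  by exists x^T; rewrite /= ?trmxK.
apply: continuous_compact.
  by apply: continuous_subspaceT => x; exact: trmx_continuous.
apply: bounded_closed_compact.
  case: bA => M [Mreal AM]; exists M; split => // r Mr x Ax.
  apply: le_trans (AM r Mr _ Ax).
  by rewrite -{1}(trmxK x) ler_norm_trmx.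
by apply: closed_comp => // x _; exact: trmx_continuous.
Qed.

Variables (N : 'cV[R]_n -> R) (N_norm : is_norm N).

Lemma norm_scale (a : R) x : N (a *: x) = `|a| * N x.
Proof. by case: N_norm. Qed.

Lemma norm_triangle x y : N (x + y) <= N x + N y.
Proof. by case: N_norm. Qed.

Lemma norm_zero : N 0 = 0.
Proof. by rewrite -(scale0r 0) norm_scale normr0 mul0r. Qed.

Lemma norm_opp x : N (- x) = N x.
Proof. by rewrite -scaleN1r norm_scale normrN normr1 mul1r. Qed.

Lemma norm_nneg x : 0 <= N x.
Proof.
have := norm_triangle x (- x); rewrite subrr norm_zero norm_opp; lra.
Qed.

Lemma norm_pos x : x != 0 -> 0 < N x.
Proof.
move=> x0; rewrite lt_neqAle norm_nneg andbT eq_sym.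
by apply: contra_neq x0 => Nx; case: N_norm => _ _; exact.
Qed.

Lemma norm_le_sup_norm : exists2 C : R, 0 < C & forall x, N x <= C * `|x|.
Proof.
exists (1 + \sum_i N (delta_mx i 0)).
  by rewrite ltr_pwDl// sumr_ge0// => i _; exact: norm_nneg.
move=> x; apply: (@le_trans _ _ (\sum_i N (delta_mx i 0) * `|x|)).
  rewrite {1}[x]matrix_sum_delta.
  under eq_bigr do rewrite big_ord1.
  elim/big_ind2 : _ => [|a y b z ay bz|i _]; first by rewrite norm_zero.
    exact: le_trans (norm_triangle _ _) (lerD ay bz).
  rewrite norm_scale mulrC ler_wpM2l ?norm_nneg//.
  rewrite [leRHS]/Num.norm/= mx_normrE.
  exact: (le_bigmax _ (fun ij => `|x ij.1 ij.2|) (i, 0)).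
by rewrite -mulr_suml ler_wpM2r// lerDr.
Qed.

Lemma is_norm_continuous : continuous N.
Proof.
have [C C0 NC] := norm_le_sup_norm.
have dN x y : N x - N y <= C * `|x - y|.
  apply: le_trans (NC _); rewrite lerBlDr.
  by apply: le_trans (norm_triangle _ _); rewrite subrK.
move=> x; apply/(@cvgrPdist_lt _ _ _ (nbhs x) (nbhs_filter x)) => e e0.
have Ce : 0 < e / C by exact: divr_gt0.
apply: filterS (nbhsx_ballx x _ Ce) => y; rewrite -ball_normE /ball_/= => xy.
apply: (@le_lt_trans _ _ (C * `|x - y|)).
  by rewrite ler_norml dN andbT lerNl opprB distrC dN.
by rewrite mulrC -ltr_pdivlMr.
Qed.

(** [N] attains a minimum on the unit sphere of the sup norm, and this minimum
    is positive because [N] is definite. *)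
Lemma norm_ge_sup_norm : exists2 m : R, 0 < m & forall x, m * `|x| <= N x.
Proof.
pose T := [set x : 'cV[R]_n | `|x| = 1].
have T_normalize x : x != 0 -> T (`|x|^-1 *: x).
  move=> x0; rewrite /T/= normrZ ger0_norm ?invr_ge0//.
  by rewrite mulVf// normr_eq0.
have [T0|/set0P/negP/negPn/eqP T0] := pselect (T !=set0); last first.
  (* The sup-norm sphere is empty only if 0 is the only vector. *)
  exists 1 => // x; have [->|/T_normalize] := eqVneq x 0.
    by rewrite normr0 mulr0 norm_zero.
  by rewrite T0.
have cT : compact T.
  apply: bounded_closed_compact_col.
    by exists 1; split=> // r r1 x /= ->; exact: ltW.
  have -> : T = Num.norm @^-1` [set 1] by [].
  apply: closed_comp; last exact: closed_eq.
  by move=> x _; exact: norm_continuous.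
have [|c cT' cmin] := compact_EVT_min T0 cT (f := N).
  by apply: continuous_subspaceT => x; exact: is_norm_continuous.
exists (N c).
  apply: norm_pos; rewrite -normr_eq0.
  by move: cT'; rewrite inE /T/= => ->; rewrite oner_neq0.
move=> x; have [->|x0] := eqVneq x 0; first by rewrite normr0 mulr0 norm_zero.
have := cmin (`|x|^-1 *: x); rewrite inE => /(_ (T_normalize _ x0)).
rewrite norm_scale ger0_norm ?invr_ge0// mulrC ler_pdivlMr// normr_gt0//.
Qed.

Lemma unit_sphere_compact : compact (unit_sphere N).
Proof.
have [m m0 mN] := norm_ge_sup_norm.
apply: bounded_closed_compact_col.
  exists m^-1; split => [|r mr x /= Nx]; first by rewrite num_real.
  apply: le_trans (ltW mr); rewrite -[leRHS]mul1r ler_pdivlMr// mulrC -Nx.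
  exact: mN.
have -> : unit_sphere N = N @^-1` [set 1] by [].
apply: closed_comp; last exact: closed_eq.
by move=> x _; exact: is_norm_continuous.
Qed.

End ColumnNorms.

(** * Growth functions *)

(** The set of points where two continuous functions differ is relatively open,
    so if it met a point over the closure of [O] it would meet one over [O]. *)
Lemma within_continuous_agree {R : realType} {T U : topologicalType}
    (S : set T) (O : set U) (f g : T * U -> R) :
  {within S `*` closure O, continuous f} ->
  {within S `*` closure O, continuous g} ->
  (forall x p, S x -> O p -> f (x, p) = g (x, p)) ->
  forall x p, S x -> closure O p -> f (x, p) = g (x, p).
Proof.
move=> cf cg fg x p Sx Op.
have cfg : {within S `*` closure O, continuous (fun z => f z - g z)}.
  exact: within_continuousB.
have xpA : (S `*` closure O) (x, p) by [].
move/subspace_continuousP : cfg => /(_ _ xpA) cfg.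
apply/eqP; rewrite -subr_eq0; apply/negP => /negP fgx.
have /cfg[[V W] [xV pW] VW] : nbhs (f (x, p) - g (x, p)) (fun r : R => r != 0).
  by apply: open_nbhs_nbhs; split => //; exact: open_neq.
have [q [Oq Wq]] := Op _ pW.
suff : f (x, q) - g (x, q) != 0 by rewrite fg// subrr eqxx.
apply: (VW (x, q)); first by split => //; exact: nbhs_singleton xV.
by split => //; exact: subset_closure.
Qed.

Section CompactTime.
Context {R : realType}.
Variables (J : set R) (J_compact : compact J) (J_lt : inf J < sup J).

Lemma time_nonempty : J !=set0.
Proof.
by apply/set0P/eqP => J0; move: J_lt; rewrite J0 inf0 sup0 ltxx.
Qed.

Lemma time_inf : J (inf J).
Proof.
have [|c] := compact_EVT_min time_nonempty J_compact (f := id).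
  by apply: continuous_subspaceT => t; exact: cvg_id.
rewrite inE => Jc cmin.
suff -> : inf J = c by [].
have lbJ : lbound J c by move=> t Jt; apply: cmin; rewrite inE.
apply/eqP; rewrite eq_le lb_le_inf ?andbT//; last exact: time_nonempty.
by apply: ge_inf Jc; exists c.
Qed.

Lemma time_sup : J (sup J).
Proof.
have [|c] := compact_EVT_max time_nonempty J_compact (f := id).
  by apply: continuous_subspaceT => t; exact: cvg_id.
rewrite inE => Jc cmax.
suff -> : sup J = c by [].
have ubJ : ubound J c by move=> t Jt; apply: cmax; rewrite inE.
apply/eqP; rewrite eq_le ge_sup//; last exact: time_nonempty.
by apply: ub_le_sup Jc; exists c.
Qed.

Lemma offdiag_nonempty : offdiag J !=set0.
Proof.
exists (sup J, inf J); split; [exact: time_sup|exact: time_inf|].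
by rewrite /= gt_eqF.
Qed.

Lemma closure_offdiag_compact : compact (closure (offdiag J)).
Proof.
have cJJ : compact (J `*` J) by exact: compact_setX.
apply: (subclosed_compact _ cJJ); first exact: closed_closure.
have /closure_id -> : closed (J `*` J).
  by apply: compact_closed cJJ; exact: norm_hausdorff.
by apply: closureS => p [].
Qed.

End CompactTime.

Section Growth.
Context {R : realType} {n : nat}.
Variables (N : 'cV[R]_n -> R) (N_norm : is_norm N).
Variables (J : set R) (J_compact : compact J) (J_lt : inf J < sup J).
Implicit Types (Phi : R -> R -> 'M[R]_n) (X : {vspace 'cV[R]_n}).

Lemma growthP Phi : LP N J Phi -> growth_extension N J Phi (growth N J Phi).
Proof. by move=> [_ exD]; exact: xgetPex. Qed.

(** The off-diagonal times are dense in their closure, so a growth extension is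
    determined there: the choice made in [growth] is immaterial. *)
Lemma growth_eq Phi D : growth_extension N J Phi D ->
  forall x p, unit_sphere N x -> closure (offdiag J) p ->
    growth N J Phi (x, p) = D (x, p).
Proof.
move=> eD; have [cG G_eq] : growth_extension N J Phi (growth N J Phi).
  by apply: xgetPex; exists D.
case: (eD) => cD D_eq.
apply: within_continuous_agree => // x p Sx Op.
by rewrite G_eq// D_eq.
Qed.

(** The factor expR (- gamma * (t - inf J)) turns into a term affine in t of
    slope - gamma under the logarithm.  Invertibility of the process keeps the
    argument of the logarithm positive. *)
Lemma log_diff_quot_shift Phi (gamma : R) x p :
  (forall t s, J t -> J s -> Phi t s \in unitmx) ->
  unit_sphere N x -> offdiag J p ->
  log_diff_quot (fun t => N (shift_process gamma Phi t (inf J) *m x)) p =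
  log_diff_quot (fun t => N (Phi t (inf J) *m x)) p - gamma.
Proof.
move=> Phi_unit Sx [Jt Js ts].
have orbit_pos t : J t -> 0 < N (Phi t (inf J) *m x).
  move=> Jt'; apply: norm_pos => //.
  have Pu := Phi_unit _ _ Jt' (time_inf J_compact J_lt).
  apply/eqP => Px0; have x0 : x = 0 by rewrite -(mulKmx Pu x) Px0 mulmx0.
  move: Sx; rewrite /unit_sphere /= x0 norm_zero// => /eqP.
  by rewrite eq_sym oner_eq0.
rewrite /log_diff_quot /shift_process -!scalemxAl !norm_scale//.
rewrite !ger0_norm ?expR_ge0// !lnM ?posrE ?expR_gt0 ?orbit_pos// !expRK.
have : p.1 - p.2 != 0 by rewrite subr_eq0.
by move=> ?; field.
Qed.

Lemma growth_shift Phi (gamma : R) x p : LP N J Phi ->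
  unit_sphere N x -> closure (offdiag J) p ->
  growth N J (shift_process gamma Phi) (x, p) = growth N J Phi (x, p) - gamma.
Proof.
move=> LPhi Sx Op; have [cG G_eq] := growthP LPhi.
case: LPhi => -[Phi_unit _ _ _ _] _.
rewrite (@growth_eq _ (fun z => growth N J Phi z - gamma))//.
split; last first.
  by move=> y q Sy Oq; rewrite log_diff_quot_shift// G_eq.
apply: within_continuousB => //.
by apply: continuous_subspaceT => z; exact: cst_continuous.
Qed.

(** Boundedness of the growth function is all that the order theory of the rates
    relies on.  Unlike membership in [LP] it is immediate for shifted processes,
    which is why the lemmas on rates are stated under this condition. *)
Definition growth_bounded_by Phi (M : R) : Prop :=
  forall x p, unit_sphere N x -> closure (offdiag J) p ->
    `|growth N J Phi (x, p)| <= M.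

Lemma growth_bounded Phi : LP N J Phi -> exists M : R, growth_bounded_by Phi M.
Proof.
move=> /growthP[cG _].
have [M [_ MP]] : bounded_set
    (growth N J Phi @` (unit_sphere N `*` closure (offdiag J))).
  apply: compact_bounded; apply: continuous_compact => //.
  apply: compact_setX; first exact: unit_sphere_compact.
  exact: closure_offdiag_compact.
exists (M + 1) => x p Sx Op; apply: (MP (M + 1)); first by rewrite ltrDl.
by exists (x, p).
Qed.

End Growth.

(** * Suprema, infima and the Hausdorff distance *)

Lemma sup_le_addr {R : realType} (A B : set R) (d : R) :
  A !=set0 -> has_ubound B ->
  (forall a, A a -> exists2 b, B b & a <= b + d) -> sup A <= sup B + d.
Proof.
move=> A0 ubB AB; apply: ge_sup => // a /AB[b Bb ab].
by apply: le_trans ab _; rewrite lerD2r ub_le_sup.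
Qed.

Lemma inf_le_addr {R : realType} (A B : set R) (d : R) :
  B !=set0 -> has_lbound A ->
  (forall b, B b -> exists2 a, A a & a <= b + d) -> inf A <= inf B + d.
Proof.
move=> B0 lbA AB; rewrite -lerBlDr; apply: lb_le_inf => // b /AB[a Aa ab].
by rewrite lerBlDr; apply: le_trans ab; apply: ge_inf.
Qed.

Lemma hausdorff_dist_le {R : realType} (A B : set R) (d : R) :
  A !=set0 -> B !=set0 ->
  (forall a, A a -> exists2 b, B b & `|a - b| <= d) ->
  (forall b, B b -> exists2 a, A a & `|b - a| <= d) ->
  hausdorff_dist A B <= d.
Proof.
have dist_le (C D : set R) : C !=set0 ->
    (forall a, C a -> exists2 b, D b & `|a - b| <= d) ->
    sup [set dist_to_set a D | a in C] <= d.
  move=> [c Cc] CD; apply: ge_sup; first by exists (dist_to_set c D), c.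
  move=> _ [a Ca <-]; have [b Db ab] := CD _ Ca.
  apply: le_trans ab; apply: ge_inf; last by exists b.
  by exists 0 => _ [e _ <-].
by move=> A0 B0 AB BA; rewrite /hausdorff_dist ge_max !dist_le.
Qed.

(** * The complement of a ladder of gaps *)

Section Gaps.
Context {R : realType}.
Implicit Types (n : nat) (u l : nat -> \bar R) (g d : R).
Local Open Scope ereal_scope.

Definition in_gap n u l (k : nat) g := u k < g%:E < l (n - k)%N.

Definition outside_gaps n u l : set R :=
  [set g | forall k, (k <= n)%N -> ~ in_gap n u l k g].

(** The properties of the extremal rates that determine the shape of the
    spectrum: [u] and [l] are finite except for the conventions at 0, and
    l j <= u k whenever a j-dimensional and a k-dimensional subspace of an
    n-dimensional space have to intersect nontrivially. *)
Definition rate_ladder n u l : Prop :=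
  [/\ u 0%N = -oo, l 0%N = +oo,
      forall k, (0 < k <= n)%N -> u k \is a fin_num /\ l k \is a fin_num &
      forall j k, (j <= n)%N -> (k <= n)%N -> (n < j + k)%N -> l j <= u k].

(** The right end l (n - k) of a nonempty gap cannot lie in its own gap, which is
    open.  If it lay in the gap of j < k, then l (n - j) <= u k would put that gap
    entirely to the left of it; if j > k, then l (n - k) <= u j would put the gap
    of j entirely to the right. *)
Lemma gap_endpoint n u l k g : rate_ladder n u l -> (k < n)%N ->
  in_gap n u l k g -> outside_gaps n u l (fine (l (n - k)%N)).
Proof.
move=> [_ _ fin_ul cross] kn /andP[ukg gl] j jn.
have [|_ lfin] := fin_ul (n - k)%N; first by lia.
rewrite /in_gap fineK//; move=> /andP[uj lj].
have [jk|kj|jk] := ltngtP j k; last by move: lj; rewrite jk ltxx.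
- have : l (n - j)%N <= u k by apply: cross; lia.
  move=> /(lt_le_trans lj)/lt_trans/(_ (lt_trans ukg gl)).
  by rewrite ltxx.
- have : l (n - k)%N <= u j by apply: cross; lia.
  by rewrite leNgt uj.
Qed.

Lemma outside_gaps_nonempty n u l : (0 < n)%N -> rate_ladder n u l ->
  outside_gaps n u l !=set0.
Proof.
move=> n0 lad; have [u0 _ fin_ul _] := lad.
have [|_ lfin] := fin_ul n; first by lia.
(* The gap of 0 is the half-line below l n, so it contains l n - 1. *)
exists (fine (l (n - 0)%N)).
apply: (@gap_endpoint _ _ _ _ (fine (l n) - 1)%R) => //.
by rewrite /in_gap u0 ltNyr subn0 -[ltRHS]fineK// lte_fin; lra.
Qed.

(** The gaps are open, and those of 0 and of n cover everything outside the
    interval from l n to u n. *)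
Lemma outside_gaps_compact n u l : (0 < n)%N -> rate_ladder n u l ->
  compact (outside_gaps n u l).
Proof.
move=> n0 [u0 l0 fin_ul _].
have [|ufin lfin] := fin_ul n; first by lia.
apply: (@subclosed_compact _ _ `[fine (l n), fine (u n)]%classic).
- have -> : outside_gaps n u l = ~` \bigcup_(k in [set k | (k <= n)%N])
      ([set g | u k < g%:E] `&` [set g | g%:E < l (n - k)%N]).
    rewrite setC_bigcup; apply/seteqP; split => g gP k kn.
      by move=> [/= ukg gl]; apply: (gP k kn); apply/andP.
    by move=> /andP[ukg gl]; apply: (gP k kn).
  apply: open_closedC; apply: bigcup_open => k _.
  by apply: openI; [exact: open_ereal_gt|exact: open_ereal_lt].
- exact: segment_compact.
move=> g gP; rewrite /= in_itv/=; apply/andP; split; rewrite leNgt; apply/negP.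
- move=> gl; apply: (gP 0%N) => //.
  by rewrite /in_gap u0 ltNyr subn0 -[ltRHS]fineK// lte_fin.
- move=> ug; apply: (gP n) => //.
  by rewrite /in_gap subnn l0 ltry andbT -[ltLHS]fineK// lte_fin.
Qed.

(** If no [b] as required exists, then a - d lies in some gap of (u', l'), and
    the right end of this gap, being outside all gaps, lies beyond a + d.
    Shrinking the gap by d on both sides gives part of a gap of (u, l) that still
    contains a.  Working with the right end of the gap replaces an appeal to the
    connectedness of the interval. *)
Lemma outside_gaps_near n u l u' l' d a : (0 <= d)%R ->
  rate_ladder n u' l' ->
  (forall k, (k <= n)%N -> u k <= u' k + d%:E) ->
  (forall k, (k <= n)%N -> l' k <= l k + d%:E) ->
  outside_gaps n u l a ->
  exists2 b, outside_gaps n u' l' b & (`|a - b| <= d)%R.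
Proof.
move=> d0 lad uu' l'l aP.
have [//|noB] :=
  pselect (exists2 b, outside_gaps n u' l' b & (`|a - b| <= d)%R).
have : ~ outside_gaps n u' l' (a - d)%R.
  move=> out; apply: noB; exists (a - d)%R => //.
  by rewrite opprB addrC subrK ger0_norm.
move=> /existsNP[k /not_implyP[kn /contrapT gapk]].
exfalso; apply: (aP k kn); case/andP: (gapk) => u'a al'.
apply/andP; split.
  apply: le_lt_trans (uu' k kn) _.
  by rewrite -lteBrDr// -EFinB.
have adl' : (a + d)%R%:E < l' (n - k)%N.
  rewrite ltNge; apply/negP => l'ad.
  have {}kn : (k < n)%N.
    rewrite ltnNge; apply/negP => nk; move: l'ad.
    have -> : (n - k = 0)%N by lia.
    by case: lad => _ -> _ _; rewrite leNgt ltry.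
  have [_ _ fin_ul _] := lad.
  have [|_ lfin] := fin_ul (n - k)%N; first by lia.
  apply: noB; exists (fine (l' (n - k)%N)); first exact: gap_endpoint gapk.
  move: al' l'ad; rewrite -[l' _]fineK// lte_fin lee_fin /=.
  rewrite ler_distlC => a1 a2; lra.
rewrite -(lteD2rE _ _ (x := d%:E))//.
by apply: lt_le_trans (l'l _ _); rewrite ?leq_subr// -EFinD.
Qed.

End Gaps.

(** * Extremal growth rates *)

Section Subspaces.
Context {K : fieldType} {vT : vectType K}.
Implicit Types X Y : {vspace vT}.

Lemma exists_subspace_dim (k : nat) : (k <= \dim {:vT})%N ->
  exists X : {vspace vT}, \dim X = k.
Proof.
move=> kn; exists <<take k (vbasis {:vT})>>%VS.
have : free (take k (vbasis {:vT}) ++ drop k (vbasis {:vT})).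
  by rewrite cat_take_drop; exact: basis_free (vbasisP _).
by move/catl_free/eqP ->; rewrite size_take size_tuple; case: ltngtP kn.
Qed.

Lemma subspaces_meet X Y : (\dim {:vT} < \dim X + \dim Y)%N ->
  exists x, [/\ x \in X, x \in Y & x != 0].
Proof.
rewrite -dimv_sum_cap => lt_dim.
have XY0 : (X :&: Y)%VS != 0%VS.
  rewrite -dimv_eq0 -lt0n; have := dimvS (subvf (X + Y)); lia.
exists (vpick (X :&: Y)); rewrite vpick0 XY0.
by have /memv_capP[] := memv_pick (X :&: Y).
Qed.

End Subspaces.

Section Rates.
Context {R : realType} {n : nat}.
Variables (N : 'cV[R]_n -> R) (N_norm : is_norm N).
Variables (J : set R) (J_compact : compact J) (J_lt : inf J < sup J).
Implicit Types (Phi Psi : R -> R -> 'M[R]_n) (X Y : {vspace 'cV[R]_n}).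

Local Notation G := (growth N J).
Local Notation low := (lower_rate N J).
Local Notation upp := (upper_rate N J).

Lemma dim_col : \dim {:'cV[R]_n} = n.
Proof. by rewrite dimvf; exact: muln1. Qed.

Lemma unit_normalize x : x != 0 -> unit_sphere N ((N x)^-1 *: x).
Proof.
move=> x0; have Nx := norm_pos N_norm x0.
by rewrite /unit_sphere /= norm_scale// ger0_norm ?invr_ge0 ?ltW// mulVf
  ?gt_eqF.
Qed.

Lemma unit_neq0 x : unit_sphere N x -> x != 0.
Proof.
move=> Sx; apply/eqP => x0; move: Sx; rewrite /unit_sphere /= x0 norm_zero//.
by move/eqP; rewrite eq_sym oner_eq0.
Qed.

Lemma growth_values_nonempty X Phi : (0 < \dim X)%N ->
  growth_values N J X Phi !=set0.
Proof.
rewrite lt0n dimv_eq0 -vpick0 => X0.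
have [p Op] := offdiag_nonempty J_compact J_lt.
exists (G Phi ((N (vpick X))^-1 *: vpick X, p)); eexists; last reflexivity.
split; last exact: subset_closure.
by split; [rewrite memvZ ?memv_pick|exact: unit_normalize].
Qed.

Section OneProcess.
Variables (Phi : R -> R -> 'M[R]_n) (M : R).
Variable PhiM : growth_bounded_by N J Phi M.

Lemma growth_values_bound X v : growth_values N J X Phi v -> - M <= v <= M.
Proof. by move=> [[x p] [[_ Sx] Op] <-]; rewrite -ler_norml; exact: PhiM. Qed.

Lemma growth_values_lb X : has_lbound (growth_values N J X Phi).
Proof. by exists (- M) => v /growth_values_bound/andP[]. Qed.

Lemma growth_values_ub X : has_ubound (growth_values N J X Phi).
Proof. by exists M => v /growth_values_bound/andP[]. Qed.

Lemma growth_ge_lower X x p : x \in X -> unit_sphere N x ->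
  closure (offdiag J) p -> low X Phi <= G Phi (x, p).
Proof.
by move=> Xx Sx Op; apply: ge_inf (growth_values_lb X) _ _; exists (x, p).
Qed.

Lemma growth_le_upper X x p : x \in X -> unit_sphere N x ->
  closure (offdiag J) p -> G Phi (x, p) <= upp X Phi.
Proof.
by move=> Xx Sx Op; apply: ub_le_sup (growth_values_ub X) _ _; exists (x, p).
Qed.

Lemma lower_rate_bound X : (0 < \dim X)%N -> - M <= low X Phi <= M.
Proof.
move=> /(growth_values_nonempty Phi)[v Xv].
apply/andP; split.
  by apply: lb_le_inf; [exists v|move=> w /growth_values_bound/andP[]].
apply: le_trans (ge_inf (growth_values_lb X) Xv) _.
by case/growth_values_bound/andP: Xv.
Qed.

Lemma upper_rate_bound X : (0 < \dim X)%N -> - M <= upp X Phi <= M.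
Proof.
move=> /(growth_values_nonempty Phi)[v Xv].
apply/andP; split; last first.
  by apply: ge_sup; [exists v|move=> w /growth_values_bound/andP[]].
apply: le_trans (ub_le_sup (growth_values_ub X) Xv).
by case/growth_values_bound/andP: Xv.
Qed.

Lemma lower_rates_ub k : (0 < k)%N ->
  has_ubound [set low X Phi | X in @Gr R n k].
Proof.
move=> k0; exists M => _ [X Xk <-]; have [|//] := andP (@lower_rate_bound X _).
by rewrite Xk.
Qed.

Lemma upper_rates_lb k : (0 < k)%N ->
  has_lbound [set upp X Phi | X in @Gr R n k].
Proof.
move=> k0; exists (- M) => _ [X Xk <-]; have [|//] := andP (@upper_rate_bound X _).
by rewrite Xk.
Qed.

Lemma lower_le_upper_cross X Y : (n < \dim X + \dim Y)%N ->
  low Y Phi <= upp X Phi.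
Proof.
rewrite -{1}dim_col => /subspaces_meet[x [Xx Yx x0]].
have [p /subset_closure Op] := offdiag_nonempty J_compact J_lt.
have Sx := unit_normalize x0.
apply: le_trans (growth_ge_lower _ Sx Op) (growth_le_upper _ Sx Op);
  by rewrite memvZ.
Qed.

Lemma rates_nonempty (f : {vspace 'cV[R]_n} -> R) k : (k <= n)%N ->
  [set f X | X in @Gr R n k] !=set0.
Proof.
rewrite -{1}dim_col => /exists_subspace_dim[X Xk].
by exists (f X), X.
Qed.

Lemma rate_ladder_ext_rates :
  rate_ladder n (upper_ext_rate N J ^~ Phi) (lower_ext_rate N J ^~ Phi).
Proof.
split => [//|//|k /andP[k0 _]|j k jn kn jk].
  by rewrite /upper_ext_rate /lower_ext_rate gtn_eqF.
rewrite /upper_ext_rate /lower_ext_rate !gtn_eqF ?lee_fin; try lia.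
apply: ge_sup; first exact: rates_nonempty.
move=> _ [Y Yj <-]; apply: lb_le_inf; first exact: rates_nonempty.
by move=> _ [X Xk <-]; apply: lower_le_upper_cross; rewrite Xk Yj addnC.
Qed.

End OneProcess.

(** * Comparison of the rates of two processes *)

Section TwoProcesses.
Variables (Phi Psi : R -> R -> 'M[R]_n) (M M' d : R).
Variable PhiM : growth_bounded_by N J Phi M.
Variable PsiM : growth_bounded_by N J Psi M'.
Local Open Scope ereal_scope.

Lemma lower_ext_rate_le k : (k <= n)%N ->
  (forall X, (0 < \dim X)%N -> low X Phi <= low X Psi + d)%R ->
  lower_ext_rate N J k Phi <= lower_ext_rate N J k Psi + d%:E.
Proof.
move=> kn low_le; rewrite /lower_ext_rate; case: posnP => [//|k0].
rewrite -EFinD lee_fin; apply: sup_le_addr; first exact: rates_nonempty.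
  exact: lower_rates_ub PsiM _ k0.
move=> _ [X Xk <-]; exists (low X Psi); first by exists X.
by apply: low_le; rewrite Xk.
Qed.

Lemma upper_ext_rate_le k : (k <= n)%N ->
  (forall X, (0 < \dim X)%N -> upp X Phi <= upp X Psi + d)%R ->
  upper_ext_rate N J k Phi <= upper_ext_rate N J k Psi + d%:E.
Proof.
move=> kn upp_le; rewrite /upper_ext_rate; case: posnP => [//|k0].
rewrite -EFinD lee_fin; apply: inf_le_addr; first exact: rates_nonempty.
  exact: upper_rates_lb PhiM _ k0.
move=> _ [X Xk <-]; exists (upp X Phi); first by exists X.
by apply: upp_le; rewrite Xk.
Qed.

Lemma lower_rate_le_growth X :
  (0 < \dim X)%N ->
  (forall x p, unit_sphere N x -> closure (offdiag J) p ->
    G Phi (x, p) <= G Psi (x, p) + d)%R ->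
  (low X Phi <= low X Psi + d)%R.
Proof.
move=> X0 GG; apply: inf_le_addr; first exact: growth_values_nonempty.
  exact: growth_values_lb PhiM _.
move=> _ [[x p] [[Xx Sx] Op] <-]; exists (G Phi (x, p)); first by exists (x, p).
exact: GG.
Qed.

Lemma upper_rate_le_growth X :
  (0 < \dim X)%N ->
  (forall x p, unit_sphere N x -> closure (offdiag J) p ->
    G Phi (x, p) <= G Psi (x, p) + d)%R ->
  (upp X Phi <= upp X Psi + d)%R.
Proof.
move=> X0 GG; apply: sup_le_addr; first exact: growth_values_nonempty.
  exact: growth_values_ub PsiM _.
move=> _ [[x p] [[Xx Sx] Op] <-]; exists (G Psi (x, p)); first by exists (x, p).
exact: GG.
Qed.

(** The lower rate of [X] is the infimum of the lower rates of the lines in [X],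
    so a comparison on lines, which is all that [rate_dist] provides, passes to
    every nonzero subspace. *)
Lemma lower_rate_le_lines X : (0 < \dim X)%N ->
  (forall x, x != 0%R -> low <[x]>%VS Phi <= low <[x]>%VS Psi + d)%R ->
  (low X Phi <= low X Psi + d)%R.
Proof.
move=> X0 line_le; rewrite -lerBlDr; apply: lb_le_inf.
  exact: growth_values_nonempty.
move=> _ [[x p] [[Xx Sx] Op] <-]; rewrite lerBlDr.
apply: (@le_trans _ _ (low <[x]>%VS Phi)).
  apply: lb_le_inf.
    by apply: growth_values_nonempty; rewrite dim_vline unit_neq0.
  move=> _ [[y q] [[x_y Sy] Oq] <-].
  apply: (growth_ge_lower PhiM) => //.
  by apply: subvP x_y; rewrite -memvE.
apply: le_trans (line_le _ (unit_neq0 Sx)) _.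
by rewrite lerD2r; apply: (growth_ge_lower PsiM) => //; rewrite memv_line.
Qed.

Lemma upper_rate_le_lines X : (0 < \dim X)%N ->
  (forall x, x != 0%R -> upp <[x]>%VS Phi <= upp <[x]>%VS Psi + d)%R ->
  (upp X Phi <= upp X Psi + d)%R.
Proof.
move=> X0 line_le; apply: ge_sup; first exact: growth_values_nonempty.
move=> _ [[x p] [[Xx Sx] Op] <-].
apply: (@le_trans _ _ (upp <[x]>%VS Phi)).
  by apply: (growth_le_upper PhiM) => //; rewrite memv_line.
apply: le_trans (line_le _ (unit_neq0 Sx)) _; rewrite lerD2r.
apply: ge_sup.
  by apply: growth_values_nonempty; rewrite dim_vline unit_neq0.
move=> _ [[y q] [[x_y Sy] Oq] <-].
apply: (growth_le_upper PsiM) => //.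
by apply: subvP x_y; rewrite -memvE.
Qed.

End TwoProcesses.

End Rates.

(** * The spectrum *)

Section Spectrum.
Context {R : realType} {n : nat}.
Variables (N : 'cV[R]_n -> R) (N_norm : is_norm N).
Variables (J : set R) (J_compact : compact J) (J_lt : inf J < sup J).
Implicit Types (Phi Psi : R -> R -> 'M[R]_n) (X : {vspace 'cV[R]_n}).

Section Shift.
Variables (Phi : R -> R -> 'M[R]_n) (LPhi : LP N J Phi) (gamma : R).
Local Notation Phig := (shift_process gamma Phi).

Lemma growth_shift_bounded M : growth_bounded_by N J Phi M ->
  growth_bounded_by N J Phig (M + `|gamma|).
Proof.
move=> PhiM x p Sx Op; rewrite growth_shift//.
by apply: le_trans (ler_normB _ _) _; rewrite lerD2r; exact: PhiM.
Qed.

Lemma ext_rates_shift k : (k <= n)%N ->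
  (lower_ext_rate N J k Phig = lower_ext_rate N J k Phi - gamma%:E /\
   upper_ext_rate N J k Phig = upper_ext_rate N J k Phi - gamma%:E)%E.
Proof.
move=> kn; have [M PhiM] := growth_bounded N_norm J_compact LPhi.
have PhigM := growth_shift_bounded PhiM.
have shift_le x p : unit_sphere N x -> closure (offdiag J) p ->
    growth N J Phig (x, p) <= growth N J Phi (x, p) - gamma.
  by move=> Sx Op; rewrite growth_shift.
have shift_ge x p : unit_sphere N x -> closure (offdiag J) p ->
    growth N J Phi (x, p) <= growth N J Phig (x, p) + gamma.
  by move=> Sx Op; rewrite growth_shift// subrK.
split; apply/eqP; rewrite eq_le leeBlDr//; apply/andP; split.
- apply: (lower_ext_rate_le N_norm J_compact J_lt PhiM) => // X X0.
  exact: (lower_rate_le_growth N_norm J_compact J_lt PhigM).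
- apply: (lower_ext_rate_le N_norm J_compact J_lt PhigM) => // X X0.
  exact: (lower_rate_le_growth N_norm J_compact J_lt PhiM).
- apply: (upper_ext_rate_le N_norm J_compact J_lt PhigM) => // X X0.
  exact: (upper_rate_le_growth N_norm J_compact J_lt PhiM).
- apply: (upper_ext_rate_le N_norm J_compact J_lt PhiM) => // X X0.
  exact: (upper_rate_le_growth N_norm J_compact J_lt PhigM).
Qed.

End Shift.

Lemma spectrumE Phi : LP N J Phi ->
  spectrum N J Phi =
  outside_gaps n (upper_ext_rate N J ^~ Phi) (lower_ext_rate N J ^~ Phi).
Proof.
move=> LPhi; apply/seteqP; split => g gP.
  move=> k kn /andP[ug gl]; apply: gP; exists k; split => //.
    by have [_ ->] := ext_rates_shift LPhi g kn; rewrite sube_lt0 ?orbT.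
  by have [-> _] := ext_rates_shift LPhi g (leq_subr k n); rewrite sube_gt0.
move=> [k [kn]].
have [_ ->] := ext_rates_shift LPhi g kn; rewrite sube_lt0 ?orbT// => ug.
have [-> _] := ext_rates_shift LPhi g (leq_subr k n); rewrite sube_gt0// => gl.
by apply: (gP k kn); rewrite /in_gap ug gl.
Qed.

(** Boundedness of both growth functions is what makes the supremum defining
    [rate_dist] an actual upper bound. *)
Lemma rate_dist_line Phi Psi X : LP N J Phi -> LP N J Psi -> \dim X = 1%N ->
  `|lower_rate N J X Phi - lower_rate N J X Psi| <= rate_dist N J Phi Psi /\
  `|upper_rate N J X Phi - upper_rate N J X Psi| <= rate_dist N J Phi Psi.
Proof.
move=> LPhi LPsi X1.
have [M PhiM] := growth_bounded N_norm J_compact LPhi.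
have [M' PsiM] := growth_bounded N_norm J_compact LPsi.
apply/andP; rewrite -ge_max; apply: ub_le_sup; last by exists X.
exists (M + M') => _ [Y Y1 <-].
have Y0 : (0 < \dim Y)%N by rewrite Y1.
have /andP[? ?] := lower_rate_bound N_norm J_compact J_lt PhiM Y0.
have /andP[? ?] := upper_rate_bound N_norm J_compact J_lt PhiM Y0.
have /andP[? ?] := lower_rate_bound N_norm J_compact J_lt PsiM Y0.
have /andP[? ?] := upper_rate_bound N_norm J_compact J_lt PsiM Y0.
rewrite ge_max !ler_norml; lra.
Qed.

Lemma rate_dist_ge0 Phi Psi : (0 < n)%N -> LP N J Phi -> LP N J Psi ->
  0 <= rate_dist N J Phi Psi.
Proof.
rewrite -{1}(@dim_col R n) => /exists_subspace_dim[X X1] LPhi LPsi.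
by apply: le_trans (rate_dist_line LPhi LPsi X1).1.
Qed.

Lemma rate_distC Phi Psi : rate_dist N J Phi Psi = rate_dist N J Psi Phi.
Proof.
by rewrite /rate_dist; congr sup; apply: eq_imagel => X _;
  rewrite distrC [X in Num.max _ X]distrC.
Qed.

Lemma ext_rates_lipschitz Phi Psi k : LP N J Phi -> LP N J Psi -> (k <= n)%N ->
  (lower_ext_rate N J k Phi
     <= lower_ext_rate N J k Psi + (rate_dist N J Phi Psi)%:E /\
   upper_ext_rate N J k Phi
     <= upper_ext_rate N J k Psi + (rate_dist N J Phi Psi)%:E)%E.
Proof.
move=> LPhi LPsi kn.
have [M PhiM] := growth_bounded N_norm J_compact LPhi.
have [M' PsiM] := growth_bounded N_norm J_compact LPsi.
have line_dist x : x != 0 -> _ :=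
  fun x0 => rate_dist_line (X := <[x]>%VS) LPhi LPsi
              (etrans (dim_vline x) (congr1 _ x0)).
split.
  apply: (lower_ext_rate_le N_norm J_compact J_lt PsiM) => // X X0.
  apply: (lower_rate_le_lines N_norm J_compact J_lt PhiM PsiM X0) => // x.
  move=> /line_dist[+ _].
  by rewrite ler_norml lerBlDl addrC => /andP[].
apply: (upper_ext_rate_le N_norm J_compact J_lt PhiM) => // X X0.
apply: (upper_rate_le_lines N_norm J_compact J_lt PhiM PsiM X0) => // x.
move=> /line_dist[_ +].
by rewrite ler_norml lerBlDl addrC => /andP[].
Qed.

Lemma spectrum_near Phi Psi a : (0 < n)%N -> LP N J Phi -> LP N J Psi ->
  spectrum N J Phi a ->
  exists2 b, spectrum N J Psi b & `|a - b| <= rate_dist N J Phi Psi.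
Proof.
move=> n0 LPhi LPsi; rewrite !spectrumE//.
have [M' PsiM] := growth_bounded N_norm J_compact LPsi.
apply: outside_gaps_near.
- exact: rate_dist_ge0.
- exact: rate_ladder_ext_rates PsiM.
- by move=> k /(ext_rates_lipschitz LPhi LPsi)[].
- by move=> k kn; rewrite rate_distC; have [] := ext_rates_lipschitz LPsi LPhi kn.
Qed.

End Spectrum.

Theorem proposition3p8 (R : realType) (n : nat) (N : 'cV[R]_n -> R)
    (J : set R) (n_gt0 : (0 < n)%N) (N_norm : is_norm N)
    (J_compact : compact J) (J_lt : inf J < sup J) :
  (forall Phi : R -> R -> 'M[R]_n, LP N J Phi ->
     nonempty_compact (spectrum N J Phi)) /\
  (forall Phi Psi : R -> R -> 'M[R]_n, LP N J Phi -> LP N J Psi ->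
     hausdorff_dist (spectrum N J Phi) (spectrum N J Psi)
       <= 1 * process_dist N J Phi Psi).
Proof.
have spectrum_ok Phi : LP N J Phi -> nonempty_compact (spectrum N J Phi).
  move=> LPhi; rewrite spectrumE//.
  have [M PhiM] := growth_bounded N_norm J_compact LPhi.
  have lad := rate_ladder_ext_rates N_norm J_compact J_lt PhiM.
  by split; [exact: outside_gaps_nonempty|exact: outside_gaps_compact].
split=> // Phi Psi LPhi LPsi; rewrite mul1r.
apply: (@le_trans _ _ (rate_dist N J Phi Psi)); last first.
  by rewrite /process_dist le_max lexx orbT.
apply: hausdorff_dist_le; [exact: (spectrum_ok _ _).1..|move=> a|move=> b].
  exact: spectrum_near.
by rewrite rate_distC; exact: spectrum_near.
Qed.
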